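(* Assume the standing assumptions, Assumption (T), and that there is $q>2$ such that $V$ is continuously embedded in $L^q(\Omega)$. Let $t>1$ with $\frac1t+\frac2q<1$. Let $\bar u$ be a local solution of $\min_{u\in V}F(u)+\frac\alpha2\|u\|_V^2+\beta\int_\Omega|u|^pdx$ and assume $F'(\bar u)\in L^t(\Omega)$ (i.e. $F'(\bar u)v=\int_\Omega F'(\bar u)v\,dx$ for $v\in V$ with a function $F'(\bar u)\in L^t(\Omega)$). Then $\bar u\in L^\infty(\Omega)$.
   Context: Standing assumptions: $\Omega\subset\mathbb R^d$ bounded Lipschitz domain; $V$ real Hilbert space with inner product $\langle\cdot,\cdot\rangle_V$, $V\subset L^2(\Omega)$ with compact and dense embedding. $F:V\to\mathbb R$ weakly lower semicontinuous, bounded below by an affine function, continuously Fréchet differentiable. $\alpha>0$, $\beta>0$, $p\in(0,1)$. A local solution $\bar u$ is one for which there is $\rho>0$ such that the objective at $\bar u$ is not larger than at any $u$ with $\|u-\bar u\|_V\le\rho$. Assumption (T): (i) for every $u\in V$ the function $v:=\max(-1,\min(u,1))$ belongs to $V$ and satisfies $\langle u,v\rangle_V\ge\|v\|_V^2$; (ii) $C_0(\Omega)\cap V$ is dense in $V$ and in $C_0(\Omega)$ with respect to their norms. *)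

(* Defs.v *)
(* R : realType; points of R^d are d.-tuples of reals,
   equipped with the product (= Borel) sigma-algebra provided by the library. *)
From HB Require Import structures.
From mathcomp Require Import all_boot all_order all_algebra.
From mathcomp Require Import all_classical all_reals all_analysis.
Set Implicit Arguments. Unset Strict Implicit. Unset Printing Implicit Defensive.
Import Order.TTheory GRing.Theory Num.Theory.
Import numFieldNormedType.Exports.
Local Open Scope classical_set_scope.
Local Open Scope ring_scope.

Definition edist {R : realType} {d : nat} (x y : d.-tuple R) : R :=
  Num.sqrt (\sum_(i < d) (tnth x i - tnth y i) ^+ 2).

Definition eopen {R : realType} {d : nat} (O : set (d.-tuple R)) : Prop :=
  forall x, O x -> exists2 r : R, 0 < r & forall y, edist x y < r -> O y.

Definition ebounded {R : realType} {d : nat} (O : set (d.-tuple R)) : Prop :=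
  exists M : R, forall x y, O x -> O y -> edist x y <= M.

Definition econnected {R : realType} {d : nat} (O : set (d.-tuple R)) : Prop :=
  forall A B : set (d.-tuple R), eopen A -> eopen B ->
    O `<=` A `|` B -> O `&` A `&` B = set0 ->
    O `&` A = set0 \/ O `&` B = set0.

Definition eclosure {R : realType} {d : nat} (O : set (d.-tuple R)) : set (d.-tuple R) :=
  [set x | forall e : R, 0 < e -> exists2 y, O y & edist x y < e].

Definition eboundary {R : realType} {d : nat} (O : set (d.-tuple R)) : set (d.-tuple R) :=
  eclosure O `\` O.

Definition rot_coord {R : realType} {d : nat} (Q : 'M[R]_d) (x0 x : d.-tuple R)
  (i : 'I_d) : R := \sum_(j < d) Q i j * (tnth x j - tnth x0 j).

Definition lipschitz_domain {R : realType} {n : nat} (Om : set (n.+1.-tuple R)) : Prop :=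
  [/\ eopen Om, ebounded Om, econnected Om, Om !=set0 &
    forall x0, eboundary Om x0 ->
      exists r : R, exists Q : 'M[R]_n.+1, exists g : n.-tuple R -> R, exists L : R,
        [/\ 0 < r, Q^T *m Q = 1%:M,
            (forall a b, `|g a - g b| <= L * edist a b) &
            forall x, edist x x0 < r ->
              (Om x <-> rot_coord Q x0 x ord_max <
                        g [tuple rot_coord Q x0 x (widen_ord (leqnSn n) i) | i < n])]].

(* Lebesgue measure on R^d: the measure on the (Borel = product) sigma-algebra
   giving each half-open box its volume; this determines it uniquely. *)
Definition ebox {R : realType} {d : nat} (a b : d.-tuple R) : set (d.-tuple R) :=
  [set x | forall i, tnth a i < tnth x i <= tnth b i].

Definition is_lebesgue {R : realType} {d : nat}
  (mu : {measure set (d.-tuple R) -> \bar R}) : Prop :=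
  forall a b : d.-tuple R, (forall i, tnth a i <= tnth b i) ->
    mu (ebox a b) = (\prod_(i < d) (tnth b i - tnth a i))%:E.

Definition in_Lp {R : realType} {d : nat} (mu : {measure set (d.-tuple R) -> \bar R})
  (Om : set (d.-tuple R)) (p : R) (f : d.-tuple R -> R) : Prop :=
  measurable_fun Om f /\ (\int[mu]_(x in Om) (`|f x| `^ p)%:E < +oo)%E.

Definition Lpnorm {R : realType} {d : nat} (mu : {measure set (d.-tuple R) -> \bar R})
  (Om : set (d.-tuple R)) (p : R) (f : d.-tuple R -> R) : R :=
  (fine (\int[mu]_(x in Om) (`|f x| `^ p)%:E)) `^ p^-1.

Definition in_Linfty {R : realType} {d : nat} (mu : {measure set (d.-tuple R) -> \bar R})
  (Om : set (d.-tuple R)) (f : d.-tuple R -> R) : Prop :=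
  measurable_fun Om f /\ exists M : R, {ae mu, forall x, Om x -> `|f x| <= M}.

Definition ae_eq_on {R : realType} {d : nat} (mu : {measure set (d.-tuple R) -> \bar R})
  (Om : set (d.-tuple R)) (f g : d.-tuple R -> R) : Prop :=
  {ae mu, forall x, Om x -> f x = g x}.

Definition in_C0 {R : realType} {d : nat} (Om : set (d.-tuple R)) (f : d.-tuple R -> R) : Prop :=
  (forall x, eclosure Om x -> forall e : R, 0 < e -> exists2 dl : R, 0 < dl &
     forall y, eclosure Om y -> edist x y < dl -> `|f x - f y| < e) /\
  (forall x, eboundary Om x -> f x = 0).

Definition inner_product_of_norm {R : realType} {V : normedModType R} (ip : V -> V -> R) : Prop :=
  [/\ forall (a : R) (u v w : V), ip (a *: u + v) w = a * ip u w + ip v w,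
      forall u v, ip u v = ip v u &
      forall v, ip v v = `|v| ^+ 2].

Definition is_linear_functional {R : realType} {V : normedModType R} (phi : V -> R) : Prop :=
  forall (a : R) (u v : V), phi (a *: u + v) = a * phi u + phi v.

Definition weakly_converges {R : realType} {V : normedModType R} (v_ : nat -> V) (v : V) : Prop :=
  forall phi : V -> R, is_linear_functional phi -> continuous phi ->
    (fun k => phi (v_ k)) @ \oo --> phi v.

Definition weakly_lsc {R : realType} {V : normedModType R} (F : V -> R) : Prop :=
  forall (v_ : nat -> V) (v : V), weakly_converges v_ v ->
    forall e : R, 0 < e -> \forall k \near \oo, F v - e < F (v_ k).

Definition bounded_below_affine {R : realType} {V : normedModType R} (F : V -> R) : Prop :=
  exists (phi : V -> R) (c : R), [/\ is_linear_functional phi, continuous phi &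
    forall v, phi v + c <= F v].

Definition C1_frechet {R : realType} {V : normedModType R} (F : V -> R) (DF : V -> V -> R) : Prop :=
  [/\ forall u, is_linear_functional (DF u) /\ continuous (DF u),
      (forall u (e : R), 0 < e -> exists2 dl : R, 0 < dl &
        forall h, `|h| < dl -> `|F (u + h) - F u - DF u h| <= e * `|h|) &
      (forall u (e : R), 0 < e -> exists2 dl : R, 0 < dl &
        forall w, `|w - u| < dl -> forall h, `|DF w h - DF u h| <= e * `|h|)].

(* V is (via the linear injection iota) compactly, continuously and densely
   embedded in L^2(Omega); functions are identified when equal a.e. on Omega *)
Definition hilbert_embedding {R : realType} {d : nat} {V : normedModType R}
  (mu : {measure set (d.-tuple R) -> \bar R}) (Om : set (d.-tuple R))
  (iota : V -> d.-tuple R -> R) : Prop :=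
  [/\ (forall (a : R) (u v : V),
         ae_eq_on mu Om (iota (a *: u + v)) (fun x => a * iota u x + iota v x))
      /\ (forall v, ae_eq_on mu Om (iota v) (fun=> 0) -> v = 0),
      (forall v, in_Lp mu Om 2 (iota v)),
      (exists C : R, forall v, Lpnorm mu Om 2 (iota v) <= C * `|v|),
      (forall v_ : nat -> V, (exists M : R, forall k, `|v_ k| <= M) ->
         exists (phi : nat -> nat) (f : d.-tuple R -> R),
           [/\ {homo phi : m k / (m < k)%N >-> (m < k)%N}, in_Lp mu Om 2 f &
               (fun k => Lpnorm mu Om 2 (fun x => iota (v_ (phi k)) x - f x)) @ \oo --> 0]) &
      (forall f, in_Lp mu Om 2 f -> forall e : R, 0 < e ->
         exists v, Lpnorm mu Om 2 (fun x => iota v x - f x) < e)].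

Definition assumption_T {R : realType} {d : nat} {V : normedModType R}
  (mu : {measure set (d.-tuple R) -> \bar R}) (Om : set (d.-tuple R))
  (iota : V -> d.-tuple R -> R) (ip : V -> V -> R) : Prop :=
  [/\ (forall u : V, exists w : V,
         ae_eq_on mu Om (iota w) (fun x => Num.max (-1) (Num.min (iota u x) 1))
         /\ `|w| ^+ 2 <= ip u w),
      (forall (u : V) (e : R), 0 < e -> exists w : V, exists c,
         [/\ in_C0 Om c, ae_eq_on mu Om (iota w) c & `|u - w| < e]) &
      (forall c (e : R), in_C0 Om c -> 0 < e -> exists w : V, exists c',
         [/\ in_C0 Om c', ae_eq_on mu Om (iota w) c' &
             forall x, eclosure Om x -> `|c x - c' x| <= e])].

Definition objective {R : realType} {d : nat} {V : normedModType R}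
  (mu : {measure set (d.-tuple R) -> \bar R}) (Om : set (d.-tuple R))
  (iota : V -> d.-tuple R -> R) (F : V -> R) (alpha beta p : R) (u : V) : R :=
  F u + alpha / 2 * `|u| ^+ 2 + beta * fine (\int[mu]_(x in Om) (`|iota u x| `^ p)%:E).

Definition local_solution {R : realType} {V : normedModType R} (J : V -> R) (ub : V) : Prop :=
  exists2 rho : R, 0 < rho & forall u, `|u - ub| <= rho -> J ub <= J u.

(* Main.v *)
(* Set w_k := u - max(-k, min(u, k)).  Scaling Assumption (T) gives <u, w_k> >= |w_k|_V^2.
   Since |u - s w_k| <= |u| pointwise for s in [0, 1], moving from u to u - s w_k does not
   increase the non-smooth L^p term, so local optimality only involves the smooth part and
   yields alpha |w_k|_V^2 <= alpha <u, w_k> <= - F'(u) w_k.  As w_k vanishes off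
   A_k := {|u| > k}, Hoelder and the embedding into L^q give
   |w_k|_q <= B |A_k|^(1 - 1/t - 1/q), hence for h > k
   (h - k)^q |A_h| <= B^q |A_k|^gamma with gamma := q (1 - 1/t - 1/q) > 1,
   and Stampacchia's iteration forces |A_M| = 0 for some M. *)
Require Import Defs.
From HB Require Import structures.
From mathcomp Require Import all_boot all_order all_algebra.
From mathcomp Require Import all_classical all_reals all_analysis.
From mathcomp Require Import measurable_realfun ring lra.
Import Order.TTheory GRing.Theory Num.Theory.
Import numFieldNormedType.Exports.
Local Open Scope classical_set_scope.
Local Open Scope ring_scope.

(** * Borel measurability of open sets, finite measure of bounded ones *)

Lemma coord_le_edist {R : realType} {d : nat} (x y : d.-tuple R) (i : 'I_d) :
  `|tnth x i - tnth y i| <= Defs.edist x y.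
Proof.
rewrite -sqrtr_sqr ler_wsqrtr// (bigD1 i)//= lerDl sumr_ge0// => j _.
exact: sqr_ge0.
Qed.

Lemma edist_le_sum {R : realType} {d : nat} (x y : d.-tuple R) :
  Defs.edist x y <= \sum_(i < d) `|tnth x i - tnth y i|.
Proof.
set s := \sum_(i < d) _.
have s0 : 0 <= s by exact: sumr_ge0.
rewrite -(ger0_norm s0) -sqrtr_sqr ler_wsqrtr// [leRHS]expr2 {1}/s.
rewrite mulr_suml ler_sum// => i _.
rewrite -real_normK ?num_real// expr2 ler_wpM2l// /s (bigD1 i)//= lerDl.
exact: sumr_ge0.
Qed.

Lemma measurable_cube {R : realType} {d : nat} (c : d.-tuple R) (e : R) :
  measurable [set x : d.-tuple R | forall i, `|tnth x i - tnth c i| < e].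
Proof.
rewrite (_ : [set x | _] =
    \bigcap_(i : 'I_d) (@tnth d R ^~ i) @^-1` [set y | `|y - tnth c i| < e]).
  apply: fin_bigcap_measurable => [|i _]; first exact: finite_finset.
  rewrite -[X in measurable X]setTI; apply: measurable_tnth => //.
  rewrite (_ : [set y | _] = `]tnth c i - e, tnth c i + e[%classic); first exact: measurable_itv.
  by apply/seteqP; split=> y; rewrite /= in_itv/= ltr_distl.
by apply/seteqP; split=> x /=; [move=> h i _; exact: h | move=> h i; exact: h].
Qed.

Lemma measurable_ebox {R : realType} {d : nat} (a b : d.-tuple R) :
  measurable (ebox a b).
Proof.
rewrite (_ : ebox a b =
    \bigcap_(i : 'I_d) (@tnth d R ^~ i) @^-1` `]tnth a i, tnth b i]%classic).
  apply: fin_bigcap_measurable => [|i _]; first exact: finite_finset.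
  by rewrite -[X in measurable X]setTI; exact: measurable_tnth.
apply/seteqP; split=> x /= h i; first by move=> _; rewrite /= in_itv/=.
by have := h i I; rewrite /= in_itv.
Qed.

(** Bridges the Euclidean metric and the product sigma-algebra: an open set is the union of the
    cubes with rational centre and half-side 1/(m+1) that it contains, and there are only countably
    many of these. *)
Lemma eopen_measurable {R : realType} {d : nat} (O : set (d.-tuple R)) :
  eopen O -> measurable O.
Proof.
move=> oO.
pose cube (c : d.-tuple rat * nat) := [set x : d.-tuple R |
  forall i, `|tnth x i - ratr (tnth c.1 i)| < c.2.+1%:R^-1].
rewrite (_ : O = \bigcup_(c in [set c | cube c `<=` O]) cube c); last first.
  apply/seteqP; split=> [x Ox|x [c /= cO]]; last exact: cO.
  have [r r0 xr] := oO x Ox.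
  (* Passing through the centre costs at most two half-sides, hence r / D, per coordinate, and d
     coordinates give d r / D < r. Using d + 1 instead of d makes this strict and keeps [D] positive
     when d = 0. *)
  pose D : R := d.+1%:R.
  have D0 : 0 < D by rewrite /D ltr0n.
  have [m mr] : exists m : nat, m.+1%:R^-1 < r / (2 * D).
    have e0 : 0 < r / (2 * D) by rewrite divr_gt0// mulr_gt0.
    exists (Num.trunc (r / (2 * D))^-1).
    rewrite invf_plt ?posrE//.
    exact: truncnS_gt.
  have hc i : exists q : rat, `|tnth x i - ratr q| < m.+1%:R^-1.
    have [|q] := @rat_in_itvoo R (tnth x i - m.+1%:R^-1) (tnth x i + m.+1%:R^-1).
      by rewrite ltrD2l gtrN// invr_gt0 ltr0n.
    by rewrite in_itv/= => /andP[q1 q2]; exists q; rewrite distrC ltr_distl q1 q2.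
  pose c := [tuple projT1 (cid (hc i)) | i < d].
  exists (c, m) => [y /= yc|i]; last first.
    by rewrite tnth_mktuple; exact: projT2 (cid (hc i)).
  apply: xr; apply: (le_lt_trans (edist_le_sum x y)).
  apply: (@le_lt_trans _ _ (\sum_(i < d) (r / D))); last first.
    rewrite sumr_const card_ord -mulr_natl mulrCA gtr_pMr// ltr_pdivrMr// mul1r.
    by rewrite /D ltr_nat.
  apply: ler_sum => i _; apply: (le_trans (ler_distD (ratr (tnth c i)) _ _)).
  rewrite [X in _ <= X](_ : _ = r / (2 * D) + r / (2 * D)); last first.
    by field; rewrite gt_eqF.
  apply: lerD; apply: ltW; apply: lt_trans mr.
    by rewrite tnth_mktuple; exact: projT2 (cid (hc i)).
  by rewrite distrC; exact: yc.
rewrite bigcup_mkcond; apply: countable_bigcupT_measurable => [|c].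
  exact: countableP.
case: ifPn => // _.
have := measurable_cube [tuple (ratr (tnth c.1 i) : R) | i < d] c.2.+1%:R^-1.
congr (measurable _); apply/seteqP.
by split=> x /= h i; have := h i; rewrite tnth_mktuple.
Qed.

Lemma ebounded_measure_lty {R : realType} {d : nat}
  (mu : {measure set (d.-tuple R) -> \bar R}) (O : set (d.-tuple R)) :
  is_lebesgue mu -> measurable O -> ebounded O -> (mu O < +oo)%E.
Proof.
move=> lmu mO [M OM].
have [->|/set0P[x Ox]] := eqVneq O set0; first by rewrite measure0.
(* The margin 1 provides the strict lower inequality of the half-open box. *)
pose a := [tuple tnth x i - (`|M| + 1) | i < d].
pose b := [tuple tnth x i + (`|M| + 1) | i < d].
apply: (@le_lt_trans _ _ (mu (ebox a b))).
  rewrite le_measure ?inE//; first exact: measurable_ebox.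
  move=> y Oy i; rewrite !tnth_mktuple.
  have := le_trans (coord_le_edist y x i) (OM _ _ Oy Ox).
  move=> /le_trans/(_ (ler_norm M)); rewrite ler_distl => /andP[h1 h2].
  by apply/andP; split; lra.
rewrite lmu ?ltry// => i; rewrite !tnth_mktuple.
have := normr_ge0 M; lra.
Qed.

(** * Hölder inequalities and Stampacchia's iteration *)

(** Follows from the inequality on the whole space by extending both functions by zero; as the
    exponents are positive, the powers vanish off [D] too. *)
Lemma hoelder_on d (T : measurableType d) (R : realType)
    (mu : {measure set T -> \bar R}) (D : set T) (f g : T -> R) (a b : R) :
  measurable D -> measurable_fun D f -> measurable_fun D g ->
  0 < a -> 0 < b -> a^-1 + b^-1 = 1 ->
  (\int[mu]_(x in D) `|f x * g x|%:E <=
   (\int[mu]_(x in D) (`|f x| `^ a)%:E) `^ a^-1 *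
   (\int[mu]_(x in D) (`|g x| `^ b)%:E) `^ b^-1)%E.
Proof.
move=> mD mf mg a0 b0 ab.
have Lp_patch c (h : T -> R) : 0 < c ->
    (\int[mu]_(x in D) (`|h x| `^ c)%:E = \int[mu]_x (`|(h \_ D) x| `^ c)%:E)%E.
  move=> c0; rewrite integral_mkcond; apply: eq_integral => x _.
  by rewrite !patchE; case: ifPn => // _; rewrite normr0 powR0 ?gt_eqF.
have mfD : measurable_fun setT (f \_ D) by exact/(measurable_restrictT _ mD).
have mgD : measurable_fun setT (g \_ D) by exact/(measurable_restrictT _ mD).
have := hoelder mu mfD mgD a0 b0 ab.
rewrite Lnorm1 unlock => h.
rewrite !Lp_patch// (le_trans _ h)// integral_mkcond le_eqVlt; apply/orP; left.
apply/eqP/eq_integral => x _ /=; rewrite !patchE.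
by case: ifPn => //= _; rewrite mul0r normr0.
Qed.

(** Almost everywhere w = w 1_A, so this is Hölder for the three factors f, w and 1_A, with
    reciprocal exponents 1/t, 1/q and 1 - 1/t - 1/q. *)
Lemma hoelder3_support {R : realType} {d : nat}
    (mu : {measure set (d.-tuple R) -> \bar R}) (D A : set (d.-tuple R))
    (f w : d.-tuple R -> R) (t q : R) :
  measurable D -> measurable A -> (mu D < +oo)%E -> A `<=` D ->
  0 < t -> 0 < q -> t^-1 + q^-1 < 1 ->
  in_Lp mu D t f -> in_Lp mu D q w ->
  {ae mu, forall x, D x -> ~ A x -> w x = 0} ->
  (\int[mu]_(x in D) `|f x * w x|%:E <=
   (Lpnorm mu D t f * Lpnorm mu D q w
    * fine (mu A) `^ (1 - t^-1 - q^-1))%:E)%E.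
Proof.
move=> mD mA Dfin AD t0 q0 tq [mf ft] [mw wq] w0.
have Afin : (mu A < +oo)%E by rewrite (le_lt_trans _ Dfin)// le_measure ?inE.
have tV0 : 0 < t^-1 by rewrite invr_gt0.
have qV0 : 0 < q^-1 by rewrite invr_gt0.
(* Hoelder twice: with exponents (r, q) for (f 1_A) w, then with (t / r, b)
   for |f|^r 1_A. *)
pose r := (1 - q^-1)^-1.
have r0 : 0 < r by rewrite invr_gt0; lra.
have rV : r^-1 = 1 - q^-1 by rewrite invrK.
(* Equivalent to 1/t + 1/q < 1; it makes t / r > 1, an admissible exponent for the second
   application. *)
have rt : r * t^-1 < 1 by rewrite -ltr_pdivlMl// mulr1 rV; lra.
pose b := (1 - r * t^-1)^-1.
have b0 : 0 < b by rewrite invr_gt0; lra.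
have bV : b^-1 = 1 - r * t^-1 by rewrite invrK.
pose s := t / r.
have s0 : 0 < s by rewrite divr_gt0.
have sV : s^-1 = r * t^-1 by rewrite invf_div.
have m1 : measurable_fun D (\1_A : _ -> R) by exact: measurable_funTS.
have mfA : measurable_fun D (fun x => f x * \1_A x) by exact: measurable_funM.
have mfr : measurable_fun D (fun x => `|f x| `^ r).
  apply: (measurableT_comp (measurable_powR r)) => //.
  exact: measurableT_comp.
have E (h : d.-tuple R -> R) (c : R) : 0 < c ->
    (\int[mu]_(x in D) (`|h x| `^ c)%:E < +oo)%E ->
    ((\int[mu]_(x in D) (`|h x| `^ c)%:E) `^ c^-1 = (Lpnorm mu D c h)%:E)%E.
  move=> c0 hc; rewrite -[X in (X `^ _)%E]fineK ?poweR_EFin//.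
  by rewrite ge0_fin_numE// integral_ge0// => x _; rewrite lee_fin powR_ge0.
have intA (c : R) : 0 < c ->
    (\int[mu]_(x in D) (`|(\1_A x : R)| `^ c)%:E = mu A)%E.
  move=> c0; rewrite -[in RHS](setIidl AD) -(integral_indic mu mD mA).
  apply: eq_integral => x _; rewrite indicE.
  by case: (x \in A); rewrite ?normr1 ?powR1// normr0 powR0// gt_eqF.
apply: (@le_trans _ _ (\int[mu]_(x in D) `|(f x * \1_A x) * w x|%:E)%E).
  apply: ae_ge0_le_integral => //.
  - by do 2 apply: measurableT_comp => //; exact: measurable_funM.
  - by do 2 apply: measurableT_comp => //; exact: measurable_funM.
  apply: filterS w0 => x wx Dx; rewrite indicE.
  have [xA|xA] := boolP (x \in A); first by rewrite mulr1.
  by rewrite wx ?mulr0//; move: xA; rewrite notin_setE.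
have rq : r^-1 + q^-1 = 1 by rewrite rV subrK.
apply: (le_trans (hoelder_on _ _ _ mu D _ _ r q mD mfA mw r0 q0 rq)).
rewrite (E w q)// mulrAC EFinM lee_wpmul2r ?lee_fin ?powR_ge0//.
have fA : (\int[mu]_(x in D) (`|f x * \1_A x| `^ r)%:E <=
    (Lpnorm mu D t f `^ r * fine (mu A) `^ (1 - r * t^-1))%:E)%E.
  have sb : s^-1 + b^-1 = 1 by rewrite sV bV addrC subrK.
  apply: (@le_trans _ _ (\int[mu]_(x in D) `|(`|f x| `^ r) * \1_A x|%:E)%E).
    rewrite le_eqVlt; apply/orP; left; apply/eqP/eq_integral => x _.
    rewrite indicE; case: (x \in A); rewrite ?mulr1 ?mulr0 ?normr0.
      by rewrite (ger0_norm (powR_ge0 _ _)).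
    by rewrite powR0// gt_eqF.
  apply: (le_trans (hoelder_on _ _ _ mu D _ _ s b mD mfr m1 s0 b0 sb)).
  rewrite intA// bV.
  rewrite -[mu A in leLHS]fineK ?ge0_fin_numE// poweR_EFin EFinM.
  rewrite lee_wpmul2r ?lee_fin ?powR_ge0//.
  under eq_integral => x _.
    rewrite (ger0_norm (powR_ge0 _ _)) -powRrM (_ : r * s = t); last first.
      by rewrite /s mulrC divfK// gt_eqF.
    over.
  rewrite -[X in (X `^ _)%E]fineK; last first.
    by rewrite ge0_fin_numE// integral_ge0// => x _; rewrite lee_fin powR_ge0.
  by rewrite poweR_EFin lee_fin /Lpnorm -powRrM sV mulrC.
have X0 : 0 <= Lpnorm mu D t f `^ r * fine (mu A) `^ (1 - r * t^-1).
  by rewrite mulr_ge0 ?powR_ge0.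
have rV0 : 0 <= r^-1 by rewrite invr_ge0 ltW.
apply: (le_trans (gt0_ler_poweR rV0 _ _ fA)).
- by rewrite in_itv/= leey andbT integral_ge0// => x _; rewrite lee_fin powR_ge0.
- by rewrite in_itv/= leey andbT lee_fin.
rewrite poweR_EFin lee_fin powRM ?powR_ge0// -!powRrM mulfV ?gt_eqF// mulr1.
rewrite (_ : (1 - r * t^-1) / r = 1 - t^-1 - q^-1)//.
transitivity (r^-1 - t^-1); first by field; rewrite !gt_eqF.
by rewrite rV addrAC.
Qed.

(* Iterate along the levels [1 + D (1 - 2^-m)], on which [phi] decays at least
   like the geometric sequence [2^-(m q / (gamma - 1))]. *)
Lemma stampacchia {R : realType} (phi : R -> R) (K q gamma : R) :
  0 < q -> 1 < gamma -> 0 <= K ->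
  (forall k, 0 <= phi k) -> {homo phi : h k /~ h <= k} ->
  (forall h k, 1 <= k -> k < h -> (h - k) `^ q * phi h <= K * phi k `^ gamma) ->
  exists M, phi M = 0.
Proof.
move=> q0 g1 K0 phi0 phi_dec step.
have [p1|p1] := eqVneq (phi 1) 0; first by exists 1.
have p1_gt0 : 0 < phi 1 by rewrite lt0r p1 phi0.
pose a := gamma - 1.
have a0 : 0 < a by rewrite subr_gt0.
have ga : gamma = 1 + a by rewrite addrC subrK.
(* The ratio is fixed by th^a = 2^-q: one step halves the gap between levels, which costs 2^q, and
   the superlinear part phi^a of the right-hand side must pay for it. *)
pose th : R := 2 `^ (- (q / a)).
have th0 : 0 < th by rewrite powR_gt0.
have tha : th `^ a = (2 `^ q)^-1.
  by rewrite -powRrM mulNr divfK ?gt_eqF// powRN.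
have th1 : th < 1.
  have : (1 : R) `^ (q / a) < 2 `^ (q / a).
    by rewrite gt0_ltr_powR ?divr_gt0 ?nnegrE// ltr1n.
  by rewrite powR1 /th powRN invf_lt1 ?powR_gt0.
(* The induction step yields D^q phi(lev (m+1)) <= X phi(1) th^(m+1), so it closes once D^q >= X.
   The + 1 in [D] keeps it positive when X = 0. *)
pose X := K * 2 `^ q * phi 1 `^ a / th.
have X0 : 0 <= X by rewrite !mulr_ge0 ?powR_ge0// invr_ge0 ltW.
pose D := (X + 1) `^ q^-1.
have D0 : 0 < D by rewrite powR_gt0// ltr_wpDl.
have DX : X <= D `^ q.
  by rewrite -powRrM mulVf ?gt_eqF// powRr1 ?lerDl ?addr_ge0.
pose lev (m : nat) := 1 + D * (1 - 2 ^- m).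
have pow2 (m : nat) : 0 < (2 ^- m : R) by rewrite invr_gt0 exprn_gt0.
have lev1 m : 1 <= lev m.
  rewrite lerDl mulr_ge0 ?(ltW D0)// subr_ge0 invf_le1 ?exprn_gt0//.
  by rewrite exprn_ege1// ler1n.
have levS m : lev m.+1 - lev m = D * 2 ^- m.+1.
  rewrite /lev; have -> : (2 ^- m : R) = 2 * 2 ^- m.+1 by rewrite exprS invfM mulrA mulfV ?mul1r.
  ring.
have decay m : phi (lev m) <= phi 1 * th ^+ m.
  elim: m => [|m IH]; first by rewrite /lev !expr0 invr1 subrr mulr0 addr0 mulr1.
  have lt_lev : lev m < lev m.+1 by rewrite -subr_gt0 levS mulr_gt0.
  have := step _ _ (lev1 m) lt_lev; rewrite levS powRM ?(ltW D0)// ?(ltW (pow2 _))//.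
  have -> : (2 ^- m.+1 : R) `^ q = (2 `^ q) ^- m.+1.
    rewrite -powR_inv1 ?exprn_ge0// -powR_mulrn// -powR_mulrn ?powR_ge0//.
    rewrite -powRN -!powRrM; congr (_ `^ _); ring.
  move=> H.
  have : D `^ q * (2 `^ q) ^- m.+1 * phi (lev m.+1) <=
      K * (phi 1 * th ^+ m) `^ gamma.
    apply: (le_trans H); rewrite ler_wpM2l//.
    by rewrite ge0_ler_powR ?nnegrE ?(ltW (lt_trans ltr01 g1))// mulr_ge0// exprn_ge0// ltW.
  (* Splitting gamma = 1 + a turns th^(m a) into 2^(-q m), which cancels the gap factor up to the
     single 2^q contained in [X]. *)
  have -> : (phi 1 * th ^+ m) `^ gamma =
      phi 1 * th ^+ m * (phi 1 `^ a * (2 `^ q) ^- m).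
    rewrite ga powRD; last by rewrite gt_eqF// addr_gt0.
    rewrite powRr1; last by rewrite mulr_ge0// exprn_ge0// ltW.
    congr (_ * _); rewrite powRM ?exprn_ge0 ?(ltW th0)//; congr (_ * _).
    by rewrite -powR_mulrn ?(ltW th0)// powRAC tha powR_mulrn ?invr_ge0 ?powR_ge0// exprVn.
  have Q0 : 0 < (2 `^ q : R) by rewrite powR_gt0.
  have Qm : 0 < ((2 `^ q) ^- m.+1 : R) by rewrite invr_gt0 exprn_gt0.
  have -> : ((2 `^ q) ^- m : R) = 2 `^ q * (2 `^ q) ^- m.+1.
    by rewrite exprS invfM mulrA mulfV ?mul1r ?gt_eqF.
  move: Qm; set Qm := (2 `^ q) ^- m.+1;
  move=> Qm0 H2.
  have {}H2 : D `^ q * phi (lev m.+1) <= K * 2 `^ q * phi 1 `^ a * (phi 1 * th ^+ m).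
    rewrite -(ler_pM2r Qm0); move: H2; congr (_ <= _); ring.
  have Xth : K * 2 `^ q * phi 1 `^ a = X * th by rewrite /X divfK// gt_eqF.
  rewrite Xth in H2.
  have Dq0 : 0 < D `^ q by rewrite powR_gt0.
  rewrite -(ler_pM2l Dq0) (le_trans H2)// -mulrA exprS.
  rewrite (_ : th * (phi 1 * th ^+ m) = phi 1 * (th * th ^+ m)); last by ring.
  by rewrite ler_wpM2r// !mulr_ge0 ?exprn_ge0 ?(ltW th0)// ltW.
(* All levels lie below 1 + D, so monotonicity bounds phi(1 + D) by phi(1) th^m for every m. *)
exists (1 + D); apply/eqP; rewrite eq_le phi0 andbT.
have cv : (fun m : nat => phi 1 * th ^+ m) @ \oo --> (phi 1 * 0).
  by apply: cvgMr; apply: cvg_expr; rewrite ger0_norm ?(ltW th0).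
rewrite mulr0 in cv.
rewrite -(cvg_lim _ cv)//; apply: limr_ge; first by apply/cvg_ex; exists 0.
apply: nearW => m; apply: le_trans (decay m); apply: phi_dec.
by rewrite lerD2l ger_pMr// gerBl ltW.
Qed.

(** Integrate |f|^p <= 1 + |f|^q over a set of finite measure. *)
Lemma in_Lp_le {R : realType} {d : nat}
    (mu : {measure set (d.-tuple R) -> \bar R}) (D : set (d.-tuple R))
    (p q : R) (f : d.-tuple R -> R) :
  measurable D -> (mu D < +oo)%E -> 0 <= p -> p <= q ->
  in_Lp mu D q f -> in_Lp mu D p f.
Proof.
move=> mD Dfin p0 pq [mf fq]; split=> //.
have mpow r : measurable_fun D (fun x => `|f x| `^ r).
  apply: (measurableT_comp (measurable_powR r)) => //.
  exact: measurableT_comp.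
apply: (@le_lt_trans _ _ (\int[mu]_(x in D) (1%:E + (`|f x| `^ q)%:E))%E).
  apply: ge0_le_integral => //.
  - by apply/measurable_EFinP.
  - apply: emeasurable_funD; first exact: measurable_cst.
    by apply/measurable_EFinP.
  move=> x _; rewrite -EFinD lee_fin.
  have [f1|f1] := leP `|f x| 1.
    have := @ge0_ler_powR R p p0 `|f x| 1.
    rewrite !nnegrE powR1 => /(_ (normr_ge0 _) ler01 f1) /le_trans; apply.
    by rewrite lerDl powR_ge0.
  by rewrite ler_wpDl//; apply: ler_powR pq; exact: ltW.
rewrite ge0_integralD//; last by apply/measurable_EFinP.
by rewrite integral_cst// mul1e lte_add_pinfty.
Qed.

(** * First-order condition in one direction *)

(** Expand the smooth part along u - s w, divide by s and let s tend to 0. The limit is replaced by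
    proving the inequality up to each e > 0 with one suitable s. *)
Lemma local_min_directional {R : realType} {V : normedModType R}
    (ip : V -> V -> R) (F : V -> R) (DF : V -> V -> R) (alpha rho : R) (u w : V) :
  inner_product_of_norm ip -> C1_frechet F DF -> 0 < alpha -> 0 < rho ->
  (forall s, 0 < s <= 1 -> `|s *: w| <= rho ->
    F u + alpha / 2 * `|u| ^+ 2 <=
    F (u - s *: w) + alpha / 2 * `|u - s *: w| ^+ 2) ->
  alpha * ip u w <= - DF u w.
Proof.
move=> [ipl ipC ipn] [DFlin DFd _] a0 rho0 minu.
have ip0 v : ip 0 v = 0.
  by have := ipl 1 0 0 v; rewrite scale1r add0r mul1r; lra.
have DF0 : DF u 0 = 0.
  by have := (DFlin u).1 1 0 0; rewrite scale1r add0r mul1r; lra.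
rewrite -subr_le0 opprK; apply/ler_addgt0Pr => e e0; rewrite add0r.
pose N := `|w|.
have N0 : 0 <= N by exact: normr_ge0.
have N1 : 0 < N + 1 by lra.
have [dl dl0 Fdl] := DFd u (e / (2 * (N + 1))) ltac:(by rewrite divr_gt0// mulr_gt0).
(* The entries after 1 keep s w in the ball of radius rho, put it strictly inside the range of the
   Fréchet estimate, and bound the quadratic term by s e / 2. The + 1 terms cover w = 0 and give the
   strictness. *)
pose s := Num.min 1 (Num.min (rho / (N + 1))
           (Num.min (dl / (N + 1)) (e / (alpha * (N ^+ 2 + 1))))).
have s0 : 0 < s.
  rewrite !lt_min ltr01/= !divr_gt0// mulr_gt0// ltr_pwDr// exprn_ge0//.
have s1 : s <= 1 by rewrite /s ge_min lexx.
have srho : s * (N + 1) <= rho.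
  by rewrite -ler_pdivlMr// /s !ge_min lexx orbT.
have sdl : s * (N + 1) <= dl.
  by rewrite -ler_pdivlMr// /s !ge_min lexx !orbT.
have N21 : 0 < alpha * (N ^+ 2 + 1) by rewrite mulr_gt0// ltr_pwDr// exprn_ge0.
have se : s * (alpha * (N ^+ 2 + 1)) <= e.
  by rewrite -ler_pdivlMr// /s !ge_min lexx !orbT.
have sw : `|s *: w| = s * N by rewrite normrZ gtr0_norm.
have /minu : 0 < s <= 1 by rewrite s0 s1.
rewrite sw => /(_ ltac:(lra)).
have := Fdl (- (s *: w)); rewrite normrN sw => /(_ ltac:(lra)).
have -> : DF u (- (s *: w)) = - s * DF u w.
  by have := (DFlin u).1 (- s) w 0; rewrite addr0 DF0 addr0 scaleNr.
have -> : `|u - s *: w| ^+ 2 = `|u| ^+ 2 - 2 * s * ip u w + s ^+ 2 * N ^+ 2.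
  have E v : ip (u - s *: w) v = - s * ip w v + ip u v.
    by rewrite -scaleNr addrC ipl.
  by rewrite -(ipn (u - s *: w)) E (ipC w) (ipC u (u - _)) !E (ipC w u) !ipn -/N; ring.
rewrite ler_norml => /andP[_ H1] H2.
have H3 : s * (DF u w + alpha * ip u w) <=
    e / (2 * (N + 1)) * (s * N) + alpha / 2 * (s ^+ 2 * N ^+ 2) by lra.
have H4 : e / (2 * (N + 1)) * (s * N) <= s * (e / 2).
  rewrite (_ : e / (2 * (N + 1)) * (s * N) = s * (e / 2) * (N / (N + 1))); last first.
    by field; rewrite gt_eqF.
  by rewrite ler_piMr ?mulr_ge0 ?(ltW s0) ?divr_ge0 ?(ltW e0)// ler_pdivrMr//; lra.
have H5 : alpha / 2 * (s ^+ 2 * N ^+ 2) <= s * (e / 2).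
  rewrite (_ : alpha / 2 * (s ^+ 2 * N ^+ 2) =
    s * (s * (alpha * N ^+ 2) / 2)); last by ring.
  by rewrite ler_pM2l// ler_pM2r//; nra.
by rewrite addrC -(ler_pM2l s0); lra.
Qed.

(** * Truncation in V and superlevel sets *)

(** Soft thresholding: for k >= 0 this is the sign of y times the positive part of |y| - k. *)
Definition excess {R : realType} (k y : R) : R := y - Num.max (- k) (Num.min y k).

Lemma excess_eq0 {R : realType} (k y : R) : `|y| <= k -> excess k y = 0.
Proof.
rewrite /excess ler_norml => /andP[ky yk].
by rewrite (min_idPl yk) (max_idPr ky) subrr.
Qed.

Lemma excess_ge {R : realType} (k y : R) : 0 <= k -> `|y| - k <= `|excess k y|.
Proof.
move=> k0; rewrite /excess.
case: (leP y k) => yk; case: (leP (- k)) => h; case: (ger0P y) => y0; try lra;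
  by case: ger0P; lra.
Qed.

(** The point moves from y towards its truncation, which lies between 0 and y, so it never crosses
    0. *)
Lemma norm_sub_excess_le {R : realType} (k y s : R) :
  0 <= k -> 0 <= s <= 1 -> `|y - s * excess k y| <= `|y|.
Proof.
move=> k0 /andP[s0 s1]; rewrite /excess.
case: (leP y k) => yk; case: (leP (- k)) => h.
- by rewrite subrr mulr0 subr0.
- have ? : y <= y - s * (y - - k) by nra.
  have ? : y - s * (y - - k) <= 0 by nra.
  by rewrite !ler0_norm//; lra.
- have ? : y - s * (y - k) <= y by nra.
  have ? : 0 <= y - s * (y - k) by nra.
  by rewrite !ger0_norm//; lra.
- by exfalso; lra.
Qed.

(** Truncate u / k at level 1 to get v and take w = u - k v. Then <u, w> - |w|^2 = k <v, w>, and <v,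
    w> = <u, v> - k |v|^2 >= 0 is Assumption (T) for u / k. *)
Lemma embedded_excess {R : realType} {d : nat} {V : normedModType R}
    (mu : {measure set (d.-tuple R) -> \bar R}) (Om : set (d.-tuple R))
    (iota : V -> d.-tuple R -> R) (ip : V -> V -> R) (u : V) (k : R) :
  inner_product_of_norm ip -> hilbert_embedding mu Om iota ->
  assumption_T mu Om iota ip -> 0 < k ->
  exists2 w : V, ae_eq_on mu Om (iota w) (fun x => excess k (iota u x)) &
    `|w| ^+ 2 <= ip u w.
Proof.
move=> [ipl ipC ipn] [[lin _] _ _ _ _] [trunc _ _] k0.
have ip0 v : ip 0 v = 0.
  by have := ipl 1 0 0 v; rewrite scale1r add0r mul1r; lra.
have ipZ a x y : ip (a *: x) y = a * ip x y.
  by have := ipl a x 0 y; rewrite ip0 !addr0.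
(* Linearity with a = 1 and zero vectors reads iota 0 = 2 iota 0 almost everywhere. *)
have lin0 : {ae mu, forall x, Om x -> iota 0 x = 0}.
  apply: filterS (lin 1 0 0) => x /[apply]; rewrite scale1r addr0; lra.
have linZ : {ae mu, forall x, Om x -> iota (k^-1 *: u) x = k^-1 * iota u x}.
  apply: filterS2 lin0 (lin k^-1 u 0) => x H1 H2 Ox.
  by have := H2 Ox; rewrite addr0 H1// addr0.
have [v [ivE vu]] := trunc (k^-1 *: u).
exists ((- k) *: v + u).
  apply: filterS3 (lin (- k) v u) ivE linZ => x H1 H2 H3 Ox.
  rewrite H1// H2// H3//.
  have -> : Num.min (k^-1 * iota u x) 1 = k^-1 * Num.min (iota u x) k.
    by rewrite minr_pMr ?invr_ge0 ?(ltW k0)// mulVf// gt_eqF.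
  have -> : -1 = k^-1 * (- k) by rewrite mulrN mulVf// gt_eqF.
  rewrite -maxr_pMr ?invr_ge0 ?(ltW k0)// mulNr mulrA mulfV ?gt_eqF// mul1r.
  by rewrite addrC.
set w := _ + u.
rewrite ipZ in vu.
have kvu : k * `|v| ^+ 2 <= ip u v by rewrite -ler_pdivlMl.
have vw : 0 <= ip v w by rewrite ipC /w ipl ipn; lra.
rewrite -ipn {1}/w ipl; have := mulr_ge0 (ltW k0) vw; lra.
Qed.

Lemma measurable_superlevel {R : realType} {d : nat} (D : set (d.-tuple R))
    (f : d.-tuple R -> R) (h : R) :
  measurable D -> measurable_fun D f ->
  measurable (D `&` [set x | h < `|f x|]).
Proof.
move=> mD mf.
rewrite [X in _ `&` X](_ : _ = (fun x => `|f x|) @^-1` `]h, +oo[%classic).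
  exact: (measurableT_comp _ mf).
by apply/seteqP; split=> x /=; rewrite in_itv/= andbT.
Qed.

(** Chebyshev's inequality: c^q times the indicator of the superlevel set of f is at most |w|^q
    almost everywhere. *)
Lemma superlevel_powR_le {R : realType} {d : nat}
    (mu : {measure set (d.-tuple R) -> \bar R}) (D : set (d.-tuple R))
    (f w : d.-tuple R -> R) (q c h : R) :
  measurable D -> (mu D < +oo)%E -> measurable_fun D f -> in_Lp mu D q w ->
  0 < q -> 0 <= c ->
  {ae mu, forall x, D x -> h < `|f x| -> c <= `|w x|} ->
  c `^ q * fine (mu (D `&` [set x | h < `|f x|])) <= Lpnorm mu D q w `^ q.
Proof.
move=> mD Dfin mf [mw wq] q0 c0 fw.
set A := D `&` _.
have mA : measurable A by exact: measurable_superlevel.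
have AD : A `<=` D by move=> x [].
have Afin : (mu A < +oo)%E by rewrite (le_lt_trans _ Dfin)// le_measure ?inE.
have mwq : measurable_fun D (fun x => `|w x| `^ q).
  apply: (measurableT_comp (measurable_powR q)) => //.
  exact: measurableT_comp.
rewrite /Lpnorm -powRrM mulVf ?gt_eqF// powRr1; last first.
  by rewrite fine_ge0// integral_ge0// => x _; rewrite lee_fin powR_ge0.
rewrite -lee_fin EFinM !fineK; last 2 first.
- by rewrite ge0_fin_numE// integral_ge0// => x _; rewrite lee_fin powR_ge0.
- by rewrite ge0_fin_numE.
rewrite -(setIidl AD) -(integral_indic mu mD mA).
rewrite -ge0_integralZl//; last first.
- by rewrite lee_fin powR_ge0.
- by apply/measurable_EFinP; exact: measurable_funTS.
apply: ae_ge0_le_integral => //.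
- by move=> x _; rewrite -EFinM lee_fin mulr_ge0 ?powR_ge0.
- under eq_fun do rewrite -EFinM.
  by apply/measurable_EFinP/measurable_funM => //; exact: measurable_funTS.
- by apply/measurable_EFinP.
apply: filterS fw => x fwx Dx; rewrite -EFinM lee_fin indicE.
have [|] := boolP (x \in A); rewrite ?mulr0 ?powR_ge0// inE mulr1 => -[_ /= hx].
by rewrite ge0_ler_powR ?nnegrE// ?(ltW q0)//; exact: fwx.
Qed.

(** * Essential boundedness of local solutions *)

Theorem theorem5p9 (R : realType) (n : nat)
  (mu : {measure set (n.+1.-tuple R) -> \bar R}) (Om : set (n.+1.-tuple R))
  (V : completeNormedModType R) (ip : V -> V -> R) (iota : V -> n.+1.-tuple R -> R)
  (F : V -> R) (DF : V -> V -> R) (alpha beta p q t : R) (ub : V) :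
  is_lebesgue mu -> lipschitz_domain Om ->
  inner_product_of_norm ip -> hilbert_embedding mu Om iota ->
  weakly_lsc F -> bounded_below_affine F -> C1_frechet F DF ->
  0 < alpha -> 0 < beta -> 0 < p < 1 ->
  assumption_T mu Om iota ip ->
  2 < q ->
  (forall v, in_Lp mu Om q (iota v)) ->
  (exists C : R, forall v, Lpnorm mu Om q (iota v) <= C * `|v|) ->
  1 < t -> t^-1 + 2 / q < 1 ->
  local_solution (objective mu Om iota F alpha beta p) ub ->
  (exists g : n.+1.-tuple R -> R, in_Lp mu Om t g /\
     forall v, (\int[mu]_(x in Om) (g x * iota v x)%:E)%E = (DF ub v)%:E) ->
  in_Linfty mu Om (iota ub).
Proof.
move=> lmu [oOm bOm _ _ _] Hip Hemb _ _ HF alpha0 beta0 /andP[p0 p1] HT q2 Lq [C Cq]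
  t1 tq [rho rho0 locmin] [g [Lg gE]].
have mOm : measurable Om by exact: eopen_measurable.
have Omfin : (mu Om < +oo)%E by exact: ebounded_measure_lty.
have [mub _] := Lq ub.
have q0 : 0 < q by lra.
have t0 : 0 < t by lra.
have qV0 : 0 < q^-1 by rewrite invr_gt0.
have tq1 : t^-1 + q^-1 < 1 by lra.
pose e := 1 - t^-1 - q^-1.
have mpow (v : V) : measurable_fun Om (fun x => `|iota v x| `^ p).
  apply: (measurableT_comp (measurable_powR p)) => //.
  by apply: measurableT_comp => //; have [] := Lq v.
have [[lin _] _ _ _ _] := Hemb.
have optimal k w : 0 < k -> ae_eq_on mu Om (iota w) (fun x => excess k (iota ub x)) ->
    alpha * ip ub w <= - DF ub w.
  move=> k0 wE; apply: (local_min_directional ip F DF alpha rho) => // s /andP[s0 s1] srho.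
  have intle : fine (\int[mu]_(x in Om) (`|iota (ub - s *: w) x| `^ p)%:E) <=
               fine (\int[mu]_(x in Om) (`|iota ub x| `^ p)%:E).
    (* Since [fine] sends an infinite integral to 0, comparing the two terms requires finiteness; it
       comes from L^q because p < q and [Om] has finite measure. *)
    have fin v : (\int[mu]_(x in Om) (`|iota v x| `^ p)%:E)%E \is a fin_num.
      rewrite ge0_fin_numE; last by rewrite integral_ge0// => x _; rewrite lee_fin powR_ge0.
      by have [] := in_Lp_le mu Om p q (iota v) mOm Omfin (ltW p0) ltac:(lra) (Lq v).
    rewrite fine_le//; apply: ae_ge0_le_integral => //; try by apply/measurable_EFinP.
    apply: filterS2 wE (lin (- s) w ub) => x wx usw Ox.
    rewrite lee_fin -scaleNr addrC usw// wx// mulNr addrC.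
    rewrite ge0_ler_powR ?nnegrE ?(ltW p0)//.
    by rewrite norm_sub_excess_le ?(ltW k0)// (ltW s0).
  have := ler_wpM2l (ltW beta0) intle.
  have := locmin (ub - s *: w); rewrite addrAC subrr add0r normrN => /(_ srho).
  rewrite /objective; lra.
pose A k := Om `&` [set x | k < `|iota ub x|].
have mA k : measurable (A k) by exact: measurable_superlevel.
have AOm k : A k `<=` Om by move=> x [].
have Afin k : (mu (A k) < +oo)%E by rewrite (le_lt_trans _ Omfin)// le_measure ?inE.
pose phi k := fine (mu (A k)).
have phi0 k : 0 <= phi k by exact: fine_ge0.
pose G := Lpnorm mu Om t g.
(* With N the L^q norm of w, N^2 <= C^2 |w|^2 and alpha |w|^2 <= G N phi(k)^e combine to N^2 <= B N
   phi(k)^e; cancelling N needs the case N = 0 apart. *)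
pose B := C ^+ 2 * G / alpha.
have G0 : 0 <= G by exact: powR_ge0.
have B0 : 0 <= B by rewrite divr_ge0 ?(ltW alpha0)// mulr_ge0 ?sqr_ge0.
have bound k w : 0 < k -> ae_eq_on mu Om (iota w) (fun x => excess k (iota ub x)) ->
    `|w| ^+ 2 <= ip ub w -> Lpnorm mu Om q (iota w) <= B * phi k `^ e.
  move=> k0 wE wip.
  pose N := Lpnorm mu Om q (iota w).
  have N0 : 0 <= N by exact: powR_ge0.
  have vanish : {ae mu, forall x, Om x -> ~ A k x -> iota w x = 0}.
    apply: filterS wE => x wx Ox Ax; rewrite wx// excess_eq0// leNgt.
    by apply/negP => kx; apply: Ax.
  have H : alpha * `|w| ^+ 2 <= G * N * phi k `^ e.
    apply: (le_trans (ler_wpM2l (ltW alpha0) wip)).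
    apply: (le_trans (optimal k w k0 wE)).
    apply: (le_trans (ler_norm _)); rewrite normrN -lee_fin.
    have -> : `|DF ub w|%:E = `|(\int[mu]_(x in Om) (g x * iota w x)%:E)%E|%E.
      by rewrite gE.
    have mgw : measurable_fun Om (fun x => g x * iota w x).
      by apply: measurable_funM; [case: Lg | case: (Lq w)].
    have /le_trans -> // := le_abse_integral mu mOm (proj2 (measurable_EFinP _ _) mgw).
    exact: hoelder3_support.
  have NC : N ^+ 2 <= C ^+ 2 * `|w| ^+ 2.
    have := Cq w; rewrite -/N => NCw; rewrite -exprMn.
    by rewrite lerXn2r ?nnegrE// (le_trans N0).
  have [N00|N00] := eqVneq N 0.
    by rewrite -/N N00 mulr_ge0 ?powR_ge0.
  have Npos : 0 < N by rewrite lt0r N00.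
  rewrite -/N -(ler_pM2l Npos) -expr2 (le_trans NC)//.
  rewrite /B; rewrite (_ : N * _ = C ^+ 2 * (G * N * phi k `^ e / alpha)); last by ring.
  by rewrite ler_wpM2l ?sqr_ge0// ler_pdivlMr// mulrC.
(* Dividing by q, this is 1/q < 1 - 1/t - 1/q, exactly the hypothesis 1/t + 2/q < 1. *)
have qe1 : 1 < e * q.
  rewrite -ltr_pdivrMr// div1r /e; lra.
have [M phiM] : exists M, phi M = 0.
  apply: (stampacchia phi (B `^ q) q (e * q)) => //; first exact: powR_ge0.
    move=> h k hk; rewrite fine_le ?ge0_fin_numE// le_measure ?inE// => x [Ox /= kx].
    by split=> //=; exact: le_lt_trans hk kx.
  move=> h k k1 kh; have k0 : 0 < k by lra.
  have [w wE wip] := embedded_excess mu Om iota ip ub k Hip Hemb HT k0.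
  (* Chebyshev applies with c = h - k, because the excess is at least |u| - k > h - k in modulus
     where |u| > h. *)
  apply: (@le_trans _ _ (Lpnorm mu Om q (iota w) `^ q)).
    apply: superlevel_powR_le => //; first by rewrite subr_ge0 ltW.
    apply: filterS wE => x wx Ox hx; rewrite wx//.
    by apply: le_trans (excess_ge k (iota ub x) (ltW k0)); lra.
  rewrite powRrM -powRM ?powR_ge0//.
  have Be0 : 0 <= B * phi k `^ e := mulr_ge0 B0 (powR_ge0 _ _).
  by rewrite ge0_ler_powR ?nnegrE ?(ltW q0) ?powR_ge0//; exact: bound.
(* The null set [A M] itself contains all the exceptional points. *)
split=> //; exists M; exists (A M); split=> //.
  by apply/eqP; rewrite -fine_eq0 ?ge0_fin_numE//; apply/eqP.
move=> x /= /not_implyP[Ox /negP]; rewrite -ltNge => Mx; by split.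
Qed.
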